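(* Let $n\ge4$. There exists an array of real numbers $\{c^{ij}_{kl}:1\le i,j,k,l\le n\}$ with $c^{ij}_{kl}=c^{ji}_{kl}$ for all $i,j,k,l$ such that the function $f:S_n\to\mathbb{R}$, $f(\sigma)=\sum_{i,j=1}^n c^{ij}_{\sigma(i)\sigma(j)}$, satisfies $$f(\sigma)=\frac{-n\bigl(p(\sigma)-1\bigr)+p(\sigma)\bigl(p(\sigma)+1\bigr)+2t(\sigma)-4}{2n-4}\qquad\text{for all }\sigma\in S_n.$$ Moreover, the average value of $f$ on $S_n$ is $0$; the maximum value of $f$ is $1$ and is attained at the identity permutation $e$ and, for even $n$, on the permutations that consist of $n/2$ disjoint transpositions; and for all $n\ge5$ and every integer $k$ with $3\le k\le n-3$, $f(\sigma)<0$ for every $\sigma\in S_n$ that moves exactly $k$ points (i.e. $|\{i:\sigma(i)\neq i\}|=k$).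
   Context: $S_n$ is the group of permutations of $\{1,\dots,n\}$; $p(\sigma)=|\{i:\sigma(i)=i\}|$ is the number of fixed points and $t(\sigma)=|\{i<j:\sigma(i)=j,\ \sigma(j)=i\}|$ the number of 2-cycles of $\sigma$. *)

(* Defs.v *)
From HB Require Import structures.
From mathcomp Require Import all_boot all_order all_fingroup all_algebra.
From mathcomp Require Import reals.

Set Implicit Arguments.
Unset Strict Implicit.
Unset Printing Implicit Defensive.

Import Order.TTheory GRing.Theory Num.Theory.

Local Open Scope ring_scope.

(* The set {1, ..., n} is represented by 'I_n = {0, ..., n-1}. *)

Definition fixed_points (n : nat) (s : 'S_n) : nat :=
  #|[set i : 'I_n | s i == i]|.

Definition moved_points (n : nat) (s : 'S_n) : nat :=
  #|[set i : 'I_n | s i != i]|.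

Definition two_cycles (n : nat) (s : 'S_n) : nat :=
  #|[set ij : 'I_n * 'I_n |
      [&& (ij.1 < ij.2)%N, s ij.1 == ij.2 & s ij.2 == ij.1]]|.

(* c i j k l stands for c^{ij}_{kl}; the diagonal terms i = j are included. *)
Definition qap_value (R : realType) (n : nat)
    (c : 'I_n -> 'I_n -> 'I_n -> 'I_n -> R) (s : 'S_n) : R :=
  \sum_(i < n) \sum_(j < n) c i j (s i) (s j).

(* s is the product of m transpositions whose 2m entries are all distinct. *)
Definition disjoint_transpositions (n m : nat) (s : 'S_n) : Prop :=
  exists ps : seq ('I_n * 'I_n),
    [/\ size ps = m,
        uniq (unzip1 ps ++ unzip2 ps)
      & s = (\prod_(ij <- ps) tperm ij.1 ij.2)%g].

Definition average (R : realType) (n : nat) (f : 'S_n -> R) : R :=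
  (\sum_(s : 'S_n) f s) / #|{: 'S_n}|%:R.

Definition is_maximum (R : realType) (n : nat) (f : 'S_n -> R) (M : R) : Prop :=
  (forall s : 'S_n, f s <= M) /\ (exists s : 'S_n, f s = M).

(* Main.v *)
Require Import Defs.
From HB Require Import structures.
From mathcomp Require Import all_boot all_order all_fingroup all_algebra.
From mathcomp Require Import reals.
From mathcomp Require Import ring lra zify.

Set Implicit Arguments.
Unset Strict Implicit.
Unset Printing Implicit Defensive.

Import Order.TTheory GRing.Theory Num.Theory.

Local Open Scope ring_scope.

(* Since [p + 2 t] counts the points [i] with [s (s i) = i], the quantity
   [p (p + 1) + 2 t] is the sum over [i, j] of
   [[s i = i] [s j = j] + [s i = j] [s j = i]], which is invariant under
   exchanging [i] and [j].  This gives the array [c]; the term [- n p] sits on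
   its diagonal [i = j] and the constant is spread evenly.  The mean follows
   from transitivity of the symmetric group on points and on ordered pairs, and
   the bounds from [p + 2 t <= n], by which the full numerator is at most
   [2 n - 4 - p (n - p)]. *)

(** * Fixed points, 2-cycles and points of period at most two *)

Lemma card_pred_sum (T : finType) (P : pred T) :
  #|[set x | P x]| = (\sum_x P x)%N.
Proof.
by rewrite -sum1dep_card big_mkcond; apply: eq_bigr => x _; case: (P x).
Qed.

(** Compare [i] with [s i]. The points with [i < s i] correspond to 2-cycles through
    [i |-> (i, s i)], those with [s i < i] are their images under [s], and equality gives the fixed
    points. *)
Lemma card_involutive_points (n : nat) (s : 'S_n) :
  #|[set i | s (s i) == i]| = (fixed_points s + 2 * two_cycles s)%N.
Proof.
have lt_card : #|[set i : 'I_n | (i < s i)%N & s (s i) == i]| = two_cycles s.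
  rewrite -(@card_imset _ _ (fun i => (i, s i))) => [|i j [] //].
  apply: eq_card => -[i j]; rewrite !inE /=.
  apply/imsetP/and3P => [[k]|[ij /eqP sij /eqP sji]].
    by rewrite inE => /andP[ltk /eqP ssk] [-> ->]; rewrite ltk ssk !eqxx.
  by exists i; rewrite ?inE ?sij ?ij ?sji ?eqxx.
have gt_card : #|[set i : 'I_n | (s i < i)%N & s (s i) == i]| = two_cycles s.
  rewrite -lt_card -(card_imset _ (@perm_inj _ s)); apply: eq_card => i.
  rewrite inE; apply/imsetP/andP => [[k]|[ltk /eqP ssk]].
    by rewrite inE => /andP[ltk /eqP ssk] ->; rewrite ssk ltk eqxx.
  by exists (s i); rewrite ?inE ?ssk ?ltk ?eqxx.
rewrite mul2n -addnn -{1}lt_card -gt_card /fixed_points !card_pred_sum.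
rewrite -!big_split; apply: eq_bigr => i _ /=.
case: (ltngtP i (s i)) => [lt|gt|/val_inj e].
- suff /negPf-> : s i != i by rewrite add0n addn0.
  by apply: contraTneq lt => ->; rewrite ltnn.
- suff /negPf-> : s i != i by [].
  by apply: contraTneq gt => ->; rewrite ltnn.
- by rewrite -e -e eqxx.
Qed.

Lemma fixed_points_two_cycles_le (n : nat) (s : 'S_n) :
  (fixed_points s + 2 * two_cycles s <= n)%N.
Proof. by rewrite -card_involutive_points -[leqRHS]card_ord max_card. Qed.

(** * Products of disjoint transpositions *)

Lemma prod_disjoint_tperm (T : finType) (ps : seq (T * T)) :
  uniq (unzip1 ps ++ unzip2 ps) ->
  (forall x, x \notin unzip1 ps ++ unzip2 ps ->
     (\prod_(ij <- ps) tperm ij.1 ij.2)%g x = x) /\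
  (forall ij, ij \in ps ->
     (\prod_(ij <- ps) tperm ij.1 ij.2)%g ij.1 = ij.2 /\
     (\prod_(ij <- ps) tperm ij.1 ij.2)%g ij.2 = ij.1).
Proof.
(* In the induction the head transposition acts first; neither [a] nor [b] occurs in the tail, so
   the tail product fixes both. *)
elim: ps => [|[a b] ps IH] /=; first by split=> // x _; rewrite big_nil perm1.
rewrite mem_cat inE /= -cat_rcons -/(cat _ _) !negb_or.
(* The entry [b] sits between the two halves; at the front it can be peeled off like [a]. *)
have perm_b : perm_eq (rcons (unzip1 ps) b ++ unzip2 ps)
    (b :: unzip1 ps ++ unzip2 ps).
  by rewrite -cat_cons perm_cat2r perm_rcons.
rewrite (perm_uniq perm_b) /= => /andP[/and3P[a1 ab a2] /andP[bP uP]].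
have aP : a \notin unzip1 ps ++ unzip2 ps by rewrite mem_cat negb_or a1.
have [fixP swapP] := IH uP; split=> [x | [c d]].
  rewrite inE (perm_mem perm_b) inE !negb_or => /and3P[xa xb xP].
  by rewrite big_cons permM tpermD 1?eq_sym //= fixP.
rewrite inE !big_cons !permM => /predU1P[[-> ->]|cd] /=.
  by rewrite tpermL tpermR !fixP.
have cP : c \in unzip1 ps ++ unzip2 ps.
  by rewrite mem_cat (map_f fst cd).
have dP : d \in unzip1 ps ++ unzip2 ps.
  by rewrite mem_cat (map_f snd cd) orbT.
have neq x y : x \notin unzip1 ps ++ unzip2 ps ->
    y \in unzip1 ps ++ unzip2 ps -> x != y.
  by move=> xP yP; apply: contraNneq xP => ->.
by rewrite !tpermD ?neq //; apply: swapP cd.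
Qed.

Lemma perfect_matching_perm (n : nat) (s : 'S_n) :
  ~~ odd n -> disjoint_transpositions n./2 s ->
  fixed_points s = 0%N /\ (2 * two_cycles s)%N = n.
Proof.
move=> ev [ps [size_ps uniq_ps ->]].
set t := (\prod_(ij <- ps) _)%g.
have [_ swap] := prod_disjoint_tperm uniq_ps.
(* The list has [2 * n./2 = n] distinct entries, as [n] is even, so it exhausts ['I_n]. *)
have cover i : i \in unzip1 ps ++ unzip2 ps.
  have : [set j in unzip1 ps ++ unzip2 ps] == [set: 'I_n].
    rewrite eqEcard subsetT cardsT card_ord cardsE (card_uniqP uniq_ps).
    by rewrite size_cat !size_map size_ps addnn even_halfK /=.
  by move=> /eqP/setP/(_ i); rewrite !inE.
have neq ij : ij \in ps -> ij.1 != ij.2.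
  move=> ijP; apply/negP => /eqP e.
  move: uniq_ps; rewrite cat_uniq => /and3P[_ /hasPn/(_ ij.2)+ _].
  by rewrite map_f // => /(_ isT)/negP; apply; rewrite -e; apply: map_f.
have t_inv i : t (t i) = i /\ t i != i.
  move: (cover i); rewrite mem_cat => /orP[] /mapP[ij ijP ->];
    have [e1 e2] := swap _ ijP.
    by rewrite /t e1 e2 eq_sym neq.
  by rewrite /t e2 e1 neq.
have p0 : fixed_points t = 0%N.
  by apply/eqP; rewrite cards_eq0; apply/eqP/setP => i;
    rewrite !inE (negPf (t_inv i).2).
split=> //; have := card_involutive_points t; rewrite p0 add0n => <-.
rewrite -[RHS]card_ord -[RHS]cardsT; apply: eq_card => i.
by rewrite !inE (t_inv i).1 eqxx.
Qed.

Lemma fixed_moved_points (n : nat) (s : 'S_n) :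
  (fixed_points s + moved_points s)%N = n.
Proof.
rewrite -[RHS]card_ord -(cardC [set i | s i == i]); congr addn.
by apply: eq_card => i; rewrite !inE.
Qed.

(** * Counting permutations with prescribed values *)

Lemma card_perm_map_point (n : nat) (i k : 'I_n) :
  #|[set s : 'S_n | s i == k]| = n.-1`!.
Proof.
have n_gt0 : (0 < n)%N by apply: leq_ltn_trans (ltn_ord i).
(* Right multiplication by a transposition carries one fibre of [s |-> s i] onto another, so the [n]
   fibres share [n!] equally. *)
have E k' : #|[set s : 'S_n | s i == k']| = #|[set s : 'S_n | s i == k]|.
  rewrite -(card_imset _ (mulIg (tperm k' k))); apply: eq_card => s.
  rewrite inE; apply/imsetP/eqP => [[u]|si].
    by rewrite inE => /eqP ui ->; rewrite permM ui tpermL.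
  exists (s * tperm k' k)%g; first by rewrite inE permM si tpermR.
  by rewrite -mulgA tperm2 mulg1.
have : (n * #|[set s : 'S_n | s i == k]| = n * n.-1`!)%N.
  rewrite -[in RHS](prednK n_gt0) -factS (prednK n_gt0) -[in RHS]card_Sn.
  rewrite -[RHS]sum1_card (partition_big (fun s : 'S_n => s i) predT) //=.
  rewrite -{1}[n]card_ord -sum_nat_const; apply: eq_bigr => k' _.
  by rewrite -(E k') -sum1dep_card.
by move=> /eqP; rewrite eqn_pmul2l // => /eqP.
Qed.

Lemma card_perm_map_pair (n : nat) (i j k l : 'I_n) : i != j -> k != l ->
  #|[set s : 'S_n | (s i == k) && (s j == l)]| = n.-2`!.
Proof.
move=> ij kl.
have n_gt1 : (1 < n)%N.
  by rewrite -[n]card_ord; apply/card_gt1P; exists i, j.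
have E k' l' : k' != l' ->
    #|[set s : 'S_n | (s i == k') && (s j == l')]| =
    #|[set s : 'S_n | (s i == k) && (s j == l)]|.
  (* The first factor sends [k'] to [k]; the second sends the image of [l'] to [l] and fixes [k],
     which differs from both. *)
  move=> kl'; pose g := (tperm k' k * tperm (tperm k' k l') l)%g.
  have gk : g k' = k.
    rewrite permM tpermL tpermD // eq_sym //.
    by rewrite -[eqbLHS](tpermL k' k) (inj_eq perm_inj).
  have gl : g l' = l by rewrite permM tpermL.
  clearbody g.
  rewrite -(card_imset _ (mulIg g)); apply: eq_card => s.
  rewrite inE; apply/imsetP/andP => [[u]|[/eqP si /eqP sj]].
    by rewrite inE => /andP[/eqP ui /eqP uj] ->; rewrite !permM ui uj gk gl.
  exists (s * g^-1)%g; last by rewrite mulgKV.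
  by rewrite inE !permM si sj -gk -gl !permK !eqxx.
have : (n * (n.-1 * #|[set s : 'S_n | (s i == k) && (s j == l)]|) =
    n * (n.-1 * n.-2`!))%N.
  have -> : (n * (n.-1 * n.-2`!))%N = n`! by case: n n_gt1 {i j k l ij kl E} => [|[]].
  rewrite -[in RHS]card_Sn.
  rewrite -[RHS]sum1_card (partition_big (fun s : 'S_n => s i) predT) //=.
  rewrite -{1}[n]card_ord -sum_nat_const; apply: eq_bigr => k' _.
  (* Once [s i = k'], injectivity leaves [n.-1] possible values for [s j]. *)
  rewrite (partition_big (fun s : 'S_n => s j) (predC1 k')) /=; last first.
    by move=> s /eqP <-; rewrite (inj_eq perm_inj) eq_sym.
  have -> : n.-1 = #|predC1 k'| by rewrite cardC1 card_ord.
  rewrite -sum_nat_const; apply: eq_bigr => l' kl'.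
  by rewrite -(E k' l') 1?eq_sym // -sum1dep_card.
by move=> /eqP; rewrite !eqn_pmul2l ?(ltnW n_gt1) -?subn1 ?subn_gt0 // => /eqP.
Qed.

(** * Sums over the symmetric group *)

Lemma sum_fixed_points (n : nat) : (0 < n)%N ->
  (\sum_(s : 'S_n) fixed_points s)%N = n`!.
Proof.
move=> n_gt0; under eq_bigr => s _ do rewrite /fixed_points card_pred_sum.
rewrite exchange_big /=.
under eq_bigr => i _ do rewrite -card_pred_sum card_perm_map_point.
by rewrite sum_nat_const card_ord; case: n n_gt0.
Qed.

(** The [n] diagonal pairs contribute [(n-1)!] each and the [n (n-1)] others [(n-2)!] each, so both
    kinds total [n!]. Abstract targets [F], [G] let one computation serve both [p ^ 2] and
    [p + 2 t]. *)
Lemma sum_perm_pairs (n : nat) (F G : 'I_n -> 'I_n -> 'I_n) : (1 < n)%N ->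
  (forall i, F i i = G i i) -> (forall i j, i != j -> F i j != G i j) ->
  (\sum_(s : 'S_n) \sum_i \sum_j ((s i == F i j) && (s j == G i j)))%N =
  (2 * n`!)%N.
Proof.
move=> n_gt1 FGeq FGneq; rewrite exchange_big /=.
have row i : (\sum_(s : 'S_n) \sum_j ((s i == F i j) && (s j == G i j)) =
    2 * n.-1`!)%N.
  rewrite exchange_big (bigD1 i) //= mul2n -addnn; congr addn.
    rewrite -(card_perm_map_point i (F i i)) card_pred_sum.
    by apply: eq_bigr => s _; rewrite -FGeq andbb.
  rewrite (eq_bigr (fun=> n.-2`!)) => [|j ji].
    rewrite sum_nat_const cardC1 card_ord.
    by case: n n_gt1 {F G FGeq FGneq i} => [|[]].
  rewrite eq_sym in ji.
  by rewrite -(card_perm_map_pair ji (FGneq _ _ ji)) card_pred_sum.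
under eq_bigr => i _ do rewrite row.
by rewrite sum_nat_const card_ord mulnCA; case: n n_gt1 {F G FGeq FGneq row}.
Qed.

Lemma fixed_points_sqrE (n : nat) (s : 'S_n) :
  (fixed_points s * fixed_points s)%N =
  (\sum_i \sum_j ((s i == i) && (s j == j)))%N.
Proof.
rewrite /fixed_points card_pred_sum big_distrlr /=.
by apply: eq_bigr => i _; apply: eq_bigr => j _; rewrite mulnb.
Qed.

Lemma fixed_points_two_cyclesE (n : nat) (s : 'S_n) :
  (fixed_points s + 2 * two_cycles s)%N =
  (\sum_i \sum_j ((s i == j) && (s j == i)))%N.
Proof.
rewrite -card_involutive_points card_pred_sum.
(* Only [j = s i] survives in the inner sum, leaving the condition [s (s i) = i]. *)
apply: eq_bigr => i _; rewrite (bigD1 (s i)) //= eqxx big1 ?addn0 //.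
by move=> j; rewrite eq_sym => /negPf->.
Qed.

(** * The coefficient array *)

Section FixedPointArray.
Variables (R : realType) (n : nat).

(** The last summand, taken over all [n ^ 2] pairs, yields [n - 4], the constant part of
    [- n (p - 1) - 4]. *)
Definition fixed_point_array (i j k l : 'I_n) : R :=
  (- n%:R * ((i == j) && (i == k))%:R + ((k == i) && (l == j))%:R
   + ((k == j) && (l == i))%:R + (n%:R - 4) / n%:R ^+ 2) / (2 * n%:R - 4).

Lemma fixed_point_arrayC (i j k l : 'I_n) :
  fixed_point_array i j k l = fixed_point_array j i k l.
Proof.
rewrite /fixed_point_array [j == i]eq_sym.
have -> : (i == j) && (j == k) = (i == j) && (i == k) by case: eqP => // ->.
by rewrite (addrAC (- _ * _)).
Qed.

Lemma qap_value_fixed_point_array (s : 'S_n) : (0 < n)%N ->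
  qap_value fixed_point_array s =
    (- n%:R * ((fixed_points s)%:R - 1)
     + (fixed_points s)%:R * ((fixed_points s)%:R + 1)
     + 2 * (two_cycles s)%:R - 4) / (2 * n%:R - 4).
Proof.
move=> n_gt0; rewrite /qap_value /fixed_point_array.
under eq_bigr => i _ do rewrite -mulr_suml !big_split /=.
rewrite -mulr_suml !big_split /=; congr (_ / _).
have -> : \sum_(i < n) \sum_(j < n) - n%:R * ((i == j) && (i == s i))%:R =
    - n%:R * (fixed_points s)%:R :> R.
  rewrite /fixed_points card_pred_sum natr_sum mulr_sumr.
  apply: eq_bigr => i _; rewrite (bigD1 i) //= eqxx big1 => [|j ji].
    by rewrite eq_sym addr0.
  by rewrite eq_sym (negPf ji) mulr0.
have -> : \sum_(i < n) \sum_(j < n) ((s i == i) && (s j == j))%:R =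
    (fixed_points s)%:R * (fixed_points s)%:R :> R.
  rewrite -natrM fixed_points_sqrE natr_sum.
  by apply: eq_bigr => i _; rewrite natr_sum.
have -> : \sum_(i < n) \sum_(j < n) ((s i == j) && (s j == i))%:R =
    (fixed_points s)%:R + 2 * (two_cycles s)%:R :> R.
  rewrite -natrM -natrD fixed_points_two_cyclesE natr_sum.
  by apply: eq_bigr => i _; rewrite natr_sum.
under eq_bigr => i _ do rewrite sumr_const card_ord.
rewrite sumr_const card_ord.
have n0 : n%:R != 0 :> R by rewrite pnatr_eq0 -lt0n.
rewrite -mulrnA -[_ *+ (n * n)]mulr_natr natrM.
by field.
Qed.

End FixedPointArray.

Theorem mainTheorem9 (R : realType) (n : nat) (hn : (4 <= n)%N) :
  exists c : 'I_n -> 'I_n -> 'I_n -> 'I_n -> R,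
    (forall i j k l : 'I_n, c i j k l = c j i k l) /\
    (forall s : 'S_n,
        qap_value c s =
          (- n%:R * ((fixed_points s)%:R - 1)
           + (fixed_points s)%:R * ((fixed_points s)%:R + 1)
           + 2 * (two_cycles s)%:R - 4)
          / (2 * n%:R - 4)) /\
    average (qap_value c) = 0 /\
    is_maximum (qap_value c) 1 /\
    qap_value c 1%g = 1 /\
    (~~ odd n ->
      forall s : 'S_n, disjoint_transpositions n./2 s -> qap_value c s = 1) /\
    ((5 <= n)%N ->
      forall k : nat, (3 <= k <= n - 3)%N ->
      forall s : 'S_n, moved_points s = k -> qap_value c s < 0).
Proof.
exists (@fixed_point_array R n).
have fE s := @qap_value_fixed_point_array R n s (ltnW (ltnW (ltnW hn))).
have n4 : 4 <= n%:R :> R by rewrite ler_nat.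
have den_gt0 : 0 < 2 * n%:R - 4 :> R by lra.
have bound (s : 'S_n) : (fixed_points s)%:R + 2 * (two_cycles s)%:R <= n%:R :> R.
  by rewrite -natrM -natrD ler_nat fixed_points_two_cycles_le.
have id1 : qap_value (@fixed_point_array R n) 1%g = 1.
  have p1 : fixed_points (1%g : 'S_n) = n.
    rewrite -[RHS]card_ord -[RHS]cardsT; apply: eq_card => i.
    by rewrite !inE perm1 eqxx.
  have t1 : two_cycles (1%g : 'S_n) = 0%N.
    by have := fixed_points_two_cycles_le (1%g : 'S_n); rewrite p1; lia.
  by rewrite fE p1 t1; field; apply: lt0r_neq0.
split; first exact: fixed_point_arrayC.
split; first exact: fE.
split; [|split; [split; last by exists 1%g |split; [exact: id1|split]]].
- rewrite /average; under eq_bigr => s _ do rewrite fE.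
  rewrite -mulr_suml.
  rewrite (_ : \sum_(s : 'S_n) _ = 0) ?mul0r //.
  have n_gt1 : (1 < n)%N := ltnW (ltnW hn).
  have S1 := @sum_fixed_points n (ltnW n_gt1).
  have S2 : (\sum_(s : 'S_n) fixed_points s * fixed_points s = 2 * n`!)%N.
    rewrite -(@sum_perm_pairs n (fun i _ => i) (fun _ j => j)) //.
    by apply: eq_bigr => s _; apply: fixed_points_sqrE.
  have S3 :
      (\sum_(s : 'S_n) (fixed_points s + 2 * two_cycles s) = 2 * n`!)%N.
    rewrite -(@sum_perm_pairs n (fun _ j => j) (fun i _ => i)) // => [|i j].
      by apply: eq_bigr => s _; apply: fixed_points_two_cyclesE.
    by rewrite eq_sym.
  (* Grouped this way, the numerators sum to [(- n + 2 + 2 + (n - 4)) n! = 0]. *)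
  rewrite (eq_bigr (fun s : 'S_n => - n%:R * (fixed_points s)%:R
    + (fixed_points s * fixed_points s)%:R
    + (fixed_points s + 2 * two_cycles s)%:R + (n%:R - 4))) => [|s _].
    rewrite !big_split /= !sumr_const card_Sn -mulr_sumr -!natr_sum S1 S2 S3.
    by rewrite -[n%:R *+ _]mulr_natr -[- 4 *+ _]mulr_natr !natrM; ring.
  by rewrite natrD !natrM; ring.
- move=> s; rewrite fE ler_pdivrMr // mul1r.
  have p_le : (fixed_points s)%:R <= n%:R :> R.
    by rewrite ler_nat -[leqRHS](fixed_moved_points s) leq_addr.
  have p_ge0 : 0 <= (fixed_points s)%:R :> R by [].
  (* The product of [p >= 0] and [n - p >= 0] is the nonlinear fact required. *)
  have := bound s; nra.
- move=> ev s /(perfect_matching_perm ev)[p0 t2].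
  by rewrite fE p0 -[2 * (two_cycles s)%:R]natrM t2; field; apply: lt0r_neq0.
- move=> _ k /andP[k3 kn] s mk; rewrite fE pmulr_llt0 ?invr_gt0 //.
  have pk : (fixed_points s)%:R = n%:R - k%:R :> R.
    by apply/(canRL (addrK _)); rewrite -natrD -mk fixed_moved_points.
  have k3R : 3 <= k%:R :> R by rewrite ler_nat.
  have knR : k%:R + 3 <= n%:R :> R by rewrite -natrD ler_nat; lia.
  (* The numerator is at most [2 n - 4 - k (n - k)]. Since [(k - 3) (n - k - 3) >= 0], this is at
     most [5 - n], negative because [n >= k + 3 >= 6]. *)
  have := bound s; rewrite pk; nra.
Qed.
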